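(* For the Invincible Fighter ($u=1$) and every $n\ge 1$, $K(n,t)$ takes all the values $n,n-1,\dots,1$ as $t$ ranges from $0$ to $\infty$; that is, for every $k\in\{1,\dots,n\}$ there is a $t\in[0,\infty)$ with $K(n,t)=k$.
   Context: Fighter problem with discrete ammunition. Fix $u\in[0,1]$ and a sequence of probabilities $0=a(0)<a(1)<a(2)<\cdots$ (each $a(j)\in[0,1]$) that is strictly increasing and strictly concave, i.e. $a(j+2)-a(j+1)< a(j+1)-a(j)$ for all $j\ge 0$. Here $a(j)$ is the probability that an enemy plane is shot down when $j$ missiles are spent on it; if it is not shot down, the fighter survives with probability $u$; enemies arrive according to a Poisson process of rate $1$. Put $c(j)=a(j)+u(1-a(j))$. For $t\ge 0$ (remaining flying time) define inductively on $n$: $N(0,t)=0$; for $r\ge 0$, $N^*(r,t)=e^{-t}\int_0^t N(r,x)e^x\,dx$ (so $N^*(0,t)=0$); for $n\ge 1$ and $1\le j\le n$, $N_n(j,t)=a(j)+c(j)N^*(n-j,t)$; and $N(n,t)=\max_{1\le j\le n}N_n(j,t)$. The optimal spending policy (smallest optimal number of missiles) is, for $n\ge1$, $K(n,t)=\min\{j\in\{1,\dots,n\}: N_n(j,t)=\max_{1\le i\le n}N_n(i,t)\}$. The Invincible Fighter is the case $u=1$, for which $c(j)=1$ and $N_n(j,t)=a(j)+N^*(n-j,t)$. *)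

(* Defs.v *)
From Stdlib Require Import Reals RList List Arith Lia Lra.
From Coquelicot Require Import Coquelicot.
Open Scope R_scope.

(** Fighter problem with discrete ammunition.  [a j] is the probability that
    the enemy is shot down by [j] missiles; [u] is the probability that the
    fighter survives an enemy that is not shot down.  All functions of [t] are
    total on [R]; only [0 <= t] is meaningful. *)

Definition c (u : R) (a : nat -> R) (j : nat) : R := a j + u * (1 - a j).

(** Expected value of [f] at the time remaining when the next enemy arrives
    (rate-1 Poisson arrivals), counting [0] if none arrives within time [t]. *)
Definition star (f : R -> R) (t : R) : R :=
  exp (- t) * RInt (fun x => f x * exp x) 0 t.

(** Writing [n = S m] and [j = S i] makes the recursive call [m - i = n - j]
    visibly decreasing; [N_max] below restates the equation with [j]. *)
Fixpoint N (u : R) (a : nat -> R) (n : nat) (t : R) {struct n} : R :=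
  match n with
  | O => 0
  | S m =>
      MaxRlist (map (fun i => a (S i) + c u a (S i) * star (N u a (m - i)) t)
                    (seq 0 (S m)))
  end.

Definition Nstar (u : R) (a : nat -> R) (r : nat) (t : R) : R :=
  star (N u a r) t.

(** [N_n(j,t)]: value of spending [j] out of [n] missiles on the enemy. *)
Definition Nspend (u : R) (a : nat -> R) (n j : nat) (t : R) : R :=
  a j + c u a j * Nstar u a (n - j) t.

(** The list of candidates is increasing, so [find] returns the smallest
    optimal [j]; the value [0] occurs only for [n = 0] (see [K_spec]). *)
Definition K (u : R) (a : nat -> R) (n : nat) (t : R) : nat :=
  match find
          (fun j =>
             if Req_EM_T (Nspend u a n j t)
                         (MaxRlist (map (fun i => Nspend u a n i t) (seq 1 n)))
             then true else false)
          (seq 1 n) with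
  | Some j => j
  | None => 0%nat
  end.

Lemma N_max (u : R) (a : nat -> R) (n : nat) (t : R) :
  N u a n t = MaxRlist (map (fun j => Nspend u a n j t) (seq 1 n)).
Proof.
  destruct n as [|m]; [reflexivity|].
  rewrite <- seq_shift, map_map. reflexivity.
Qed.

Lemma MaxRlist_In (l : list R) : l <> nil -> In (MaxRlist l) l.
Proof.
  induction l as [|x [|y l] IH]; intros Hl.
  - now elim Hl.
  - now left.
  - change (MaxRlist (x :: y :: l)) with (Rmax x (MaxRlist (y :: l))).
    destruct (Rmax_case_strong x (MaxRlist (y :: l))
                (fun z => z = x \/ z = MaxRlist (y :: l))) as [E|E]; auto.
    + left. now rewrite E.
    + right. rewrite E. apply IH. discriminate.
Qed.

Lemma find_seq_least (p : nat -> bool) (len s k : nat) :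
  find p (seq s len) = Some k ->
  (s <= k < s + len)%nat /\ p k = true /\
  forall j, (s <= j < k)%nat -> p j = false.
Proof.
  revert s. induction len as [|len IH]; intros s; simpl; [discriminate|].
  destruct (p s) eqn:E.
  - intros [= <-]. repeat split; auto; lia.
  - intros H. destruct (IH _ H) as (H1 & H2 & H3).
    repeat split; auto; try lia.
    intros j Hj. destruct (Nat.eq_dec j s) as [->|]; [exact E|].
    apply H3; lia.
Qed.

Lemma K_spec (u : R) (a : nat -> R) (n : nat) (t : R) :
  (1 <= n)%nat ->
  (1 <= K u a n t <= n)%nat /\
  (forall i, (1 <= i <= n)%nat ->
     Nspend u a n i t <= Nspend u a n (K u a n t) t) /\
  (forall j, (1 <= j < K u a n t)%nat ->
     Nspend u a n j t < Nspend u a n (K u a n t) t).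
Proof.
  intros Hn. unfold K.
  set (M := MaxRlist _). set (p := fun j : nat => _).
  assert (HM : forall i, (1 <= i <= n)%nat -> Nspend u a n i t <= M).
  { intros i Hi. apply MaxRlist_P1.
    apply (in_map (fun i => Nspend u a n i t)), in_seq. lia. }
  assert (Hp : forall j, p j = true <-> Nspend u a n j t = M).
  { intros j. unfold p. destruct Req_EM_T; split; easy. }
  destruct (find p (seq 1 n)) as [k|] eqn:E.
  - destruct (find_seq_least _ _ _ _ E) as (H1 & H2 & H3).
    apply Hp in H2. repeat split; try lia; rewrite H2.
    + exact HM.
    + intros j Hj. destruct (HM j) as [Hlt|Heq]; [lia|exact Hlt|].
      apply Hp in Heq. rewrite H3 in Heq; [discriminate|lia].
  - exfalso.
    assert (Hin : In M (map (fun i => Nspend u a n i t) (seq 1 n))).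
    { apply MaxRlist_In. destruct n; [lia|discriminate]. }
    apply in_map_iff in Hin. destruct Hin as (k & Hk & Hin).
    apply Hp in Hk. rewrite (find_none _ _ E _ Hin) in Hk. discriminate.
Qed.

(* Main.v *)
(** Write [g r = N*(r, t)].  Spending [j] missiles beats spending [j + 1] exactly
    when [g (n - j) - g (n - j - 1) >= a (j + 1) - a j].  Since [N(n, t)] is a
    sup-convolution of the concave sequences [a] and [g], and [N*] is a positive
    linear image of [N], the sequence [g] is concave by induction.  Therefore
    [K(n, t) = k < n] as soon as [g (n - k) - g (n - k - 1) = a (k + 1) - a k].
    This increment of [g] is continuous in [t], is [0] at [t = 0] and tends to
    [a 1 > a (k + 1) - a k], so such a [t] exists by the intermediate value
    theorem; [k = n] is attained at [t = 0]. *)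

From Stdlib Require Import Reals RList List Arith Lia Lra.
From Coquelicot Require Import Coquelicot.
Require Import Defs.
Open Scope R_scope.

(** * Continuity of finite maxima *)

Lemma continuous_Rmax (f g : R -> R) (x : R) :
  continuous f x -> continuous g x -> continuous (fun y => Rmax (f y) (g y)) x.
Proof.
  intros Hf Hg.
  apply (continuous_ext (fun y => (f y + g y + Rabs (f y - g y)) * / 2)).
  { intros y. unfold Rmax, Rabs.
    destruct Rle_dec, Rcase_abs; simpl; lra. }
  apply (continuous_mult (K := R_AbsRing)); [|apply continuous_const].
  apply (continuous_plus (V := R_NormedModule)).
  - now apply (continuous_plus (V := R_NormedModule)).
  - apply continuous_Rabs_comp.
    now apply (continuous_minus (V := R_NormedModule)).
Qed.

Lemma continuous_MaxRlist {A : Type} (f : A -> R -> R) (l : list A) (x : R) :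
  (forall i, In i l -> continuous (f i) x) ->
  continuous (fun y => MaxRlist (map (fun i => f i y) l)) x.
Proof.
  induction l as [|i [|j l] IH]; intros H.
  - apply continuous_const.
  - apply H. now left.
  - apply (continuous_Rmax (f i)).
    + apply H. now left.
    + apply IH. intros i' Hi'. apply H. now right.
Qed.

(** * The averaging operator [star]: continuity, positivity, additivity, exponential bounds *)

Lemma continuous_mul_exp (f : R -> R) (x : R) :
  continuous f x -> continuous (fun y => f y * exp y) x.
Proof.
  intros H. apply (continuous_mult (K := R_AbsRing)); [exact H|].
  apply continuous_exp.
Qed.

Lemma ex_RInt_mul_exp (f : R -> R) (s t : R) :
  (forall x, continuous f x) -> ex_RInt (fun x => f x * exp x) s t.
Proof.
  intros H. apply (ex_RInt_continuous (V := R_CompleteNormedModule)).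
  intros z _. now apply continuous_mul_exp.
Qed.

Lemma star_0 (f : R -> R) : star f 0 = 0.
Proof. unfold star. rewrite RInt_point. apply Rmult_0_r. Qed.

Lemma star_continuous (f : R -> R) (t : R) :
  (forall x, continuous f x) -> continuous (star f) t.
Proof.
  intros H. unfold star.
  apply (continuous_mult (K := R_AbsRing)).
  - apply (continuous_comp Ropp exp); [|apply continuous_exp].
    apply (continuous_opp (V := R_NormedModule)), continuous_id.
  - apply (continuous_RInt_1 (V := R_NormedModule)
             (fun x => f x * exp x) 0 t).
    apply filter_forall. intros z.
    now apply (RInt_correct (V := R_CompleteNormedModule)), ex_RInt_mul_exp.
Qed.

Lemma star_le (f g : R -> R) (t : R) :
  (forall x, continuous f x) -> (forall x, continuous g x) -> 0 <= t ->
  (forall x, 0 <= x <= t -> f x <= g x) -> star f t <= star g t.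
Proof.
  intros Hf Hg Ht H. unfold star.
  apply Rmult_le_compat_l; [apply Rlt_le, exp_pos|].
  apply RInt_le; auto using ex_RInt_mul_exp.
  intros x Hx. apply Rmult_le_compat_r; [apply Rlt_le, exp_pos|].
  apply H. lra.
Qed.

Lemma star_plus (f g : R -> R) (t : R) :
  (forall x, continuous f x) -> (forall x, continuous g x) ->
  star (fun x => f x + g x) t = star f t + star g t.
Proof.
  intros Hf Hg. unfold star.
  rewrite (RInt_ext _ (fun x => plus (f x * exp x) (g x * exp x))).
  2:{ intros x _. unfold plus. simpl. ring. }
  rewrite (RInt_plus (V := R_CompleteNormedModule));
    auto using ex_RInt_mul_exp.
  unfold plus. simpl. ring.
Qed.

(** Integrating factor: [(f + df) * exp] is the derivative of [f * exp]. Thus [star] solves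
    [y' + y = h] with [y 0 = 0], and explicit comparison functions can be put through it without
    computing integrals. *)
Lemma star_primitive (f df : R -> R) (t : R) :
  (forall x, is_derive f x (df x)) -> (forall x, continuous df x) ->
  star (fun x => f x + df x) t = f t - exp (- t) * f 0.
Proof.
  intros Hd Hc. unfold star.
  assert (Hf : forall x, continuous f x).
  { intros x. apply (ex_derive_continuous (V := R_NormedModule)).
    now exists (df x). }
  rewrite (is_RInt_unique _ _ _ (f t * exp t - f 0 * exp 0)).
  - assert (E : exp (- t) * exp t = 1).
    { rewrite <- exp_plus, Rplus_opp_l. apply exp_0. }
    rewrite exp_0. replace (f t) with (f t * (exp (- t) * exp t)) at 2.
    + ring.
    + rewrite E. ring.
  - apply (is_RInt_derive (V := R_CompleteNormedModule)
             (fun x => f x * exp x)).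
    + intros x _. apply (is_derive_ext (fun x => mult (f x) (exp x))).
      { reflexivity. }
      replace ((f x + df x) * exp x)
        with (plus (mult (df x) (exp x)) (mult (f x) (exp x)))
        by (unfold plus, mult; simpl; ring).
      apply (is_derive_mult f exp x).
      * apply Hd.
      * apply is_derive_exp.
      * intros; apply Rmult_comm.
    + intros x _. apply continuous_mul_exp.
      now apply (continuous_plus (V := R_NormedModule)).
Qed.

Lemma star_const (m t : R) : star (fun _ => m) t = m * (1 - exp (- t)).
Proof.
  transitivity (star (fun x => m + 0) t).
  - unfold star. f_equal. apply RInt_ext. intros x _.
    now rewrite Rplus_0_r.
  - rewrite (star_primitive (fun _ => m) (fun _ => 0)).
    + ring.
    + intros x. apply (is_derive_const (V := R_NormedModule)).
    + intros x. apply continuous_const.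
Qed.

(* [m - 2 C e^(-x/2)] is a subsolution of the equation [y' + y = f] of
   [y = star f], with nonpositive initial value. *)
Lemma star_ge_exp (f : R -> R) (m C t : R) :
  (forall x, continuous f x) -> 0 <= t -> m <= 2 * C ->
  (forall x, 0 <= x -> m - C * exp (- x / 2) <= f x) ->
  m - 2 * C * exp (- t / 2) <= star f t.
Proof.
  intros Hf Ht HC H.
  set (F := fun x => m - 2 * C * exp (- x / 2)).
  set (dF := fun x => C * exp (- x / 2)).
  assert (HF : forall x, is_derive F x (dF x)).
  { intros x. unfold F, dF. auto_derive; [trivial|]. 
    change (- x / 2) with (- x * / 2). simpl. field. }
  assert (HdF : forall x, continuous dF x).
  { intros x. apply (ex_derive_continuous (V := R_NormedModule)).
    unfold dF. auto_derive. trivial. }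
  apply Rle_trans with (star (fun x => F x + dF x) t).
  - rewrite (star_primitive F dF t HF HdF).
    assert (F 0 <= 0).
    { unfold F. replace (- 0 / 2) with 0 by field. rewrite exp_0. lra. }
    pose proof (exp_pos (- t)). fold (F t). nra.
  - apply star_le; auto.
    + intros x. apply (continuous_plus (V := R_NormedModule)); auto.
      apply (ex_derive_continuous (V := R_NormedModule)). now exists (dF x).
    + intros x Hx. unfold F, dF. specialize (H x). lra.
Qed.

(** * Concave sequences and the optimality equation for [N] *)

(** Increments of a concave sequence decrease. Concavity is assumed only for [i < q], so that a
    strong induction hypothesis can supply it. *)
Lemma concave_exchange (g : nat -> R) (p q : nat) :
  (forall i, (i < q)%nat -> g i + g (S (S i)) <= 2 * g (S i)) ->
  (p <= q)%nat -> g p + g (S q) <= g (S p) + g q.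
Proof.
  intros H Hpq. induction Hpq as [|q Hpq IH]; [lra|].
  assert (g p + g (S q) <= g (S p) + g q) by (apply IH; intros; apply H; lia).
  specialize (H q). assert (g q + g (S (S q)) <= 2 * g (S q)) by (apply H; lia).
  lra.
Qed.

Lemma N_continuous (u : R) (a : nat -> R) (n : nat) (t : R) :
  continuous (N u a n) t.
Proof.
  revert t. induction n as [n IH] using lt_wf_ind. intros t.
  apply (continuous_ext
           (fun t => MaxRlist (map (fun j => Nspend u a n j t) (seq 1 n)))).
  { intros s. symmetry. apply N_max. }
  apply (continuous_MaxRlist (fun j => Nspend u a n j)).
  intros j Hj. apply in_seq in Hj. unfold Nspend.
  apply (continuous_plus (V := R_NormedModule)); [apply continuous_const|].
  apply (continuous_mult (K := R_AbsRing)); [apply continuous_const|].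
  apply star_continuous. intros x. apply IH. lia.
Qed.

Lemma Nstar_continuous (u : R) (a : nat -> R) (r : nat) (t : R) :
  continuous (Nstar u a r) t.
Proof. apply star_continuous. intros x. apply N_continuous. Qed.

Lemma Nstar_0 (u : R) (a : nat -> R) (t : R) : Nstar u a 0 t = 0.
Proof.
  unfold Nstar. change (N u a 0) with (fun _ : R => 0).
  rewrite star_const. ring.
Qed.

Lemma Nspend_1 (a : nat -> R) (n j : nat) (t : R) :
  Nspend 1 a n j t = a j + Nstar 1 a (n - j) t.
Proof. unfold Nspend, c. ring. Qed.

Lemma N_ge (a : nat -> R) (n j : nat) (t : R) :
  (1 <= j <= n)%nat -> a j + Nstar 1 a (n - j) t <= N 1 a n t.
Proof.
  intros Hj. rewrite N_max, <- Nspend_1. apply MaxRlist_P1.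
  apply (in_map (fun i => Nspend 1 a n i t)), in_seq. lia.
Qed.

Lemma N_attained (a : nat -> R) (n : nat) (t : R) :
  (1 <= n)%nat ->
  exists j, (1 <= j <= n)%nat /\ N 1 a n t = a j + Nstar 1 a (n - j) t.
Proof.
  intros Hn.
  assert (H : In (N 1 a n t) (map (fun j => Nspend 1 a n j t) (seq 1 n))).
  { rewrite N_max. apply MaxRlist_In. destruct n; [lia|discriminate]. }
  apply in_map_iff in H. destruct H as (j & Hj & Hin). apply in_seq in Hin.
  exists j. split; [lia|]. now rewrite <- Hj, Nspend_1.
Qed.

(** * Growth in [t] and concavity in the number of missiles, for [u = 1] *)

Section ConcaveHits.

Variable a : nat -> R.
Hypothesis a_0 : a 0%nat = 0.
Hypothesis a_incr : forall j, a j <= a (S j).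
Hypothesis a_conc : forall j, a j + a (S (S j)) <= 2 * a (S j).

Lemma concave_le_linear (j : nat) : a (S j) <= a j + a 1%nat.
Proof.
  pose proof (concave_exchange a 0 j (fun i _ => a_conc i)).
  assert (a 0%nat + a (S j) <= a 1%nat + a j) by (apply H; lia). lra.
Qed.

(** No missile is worth more than [a 1]: concavity gives this for those spent now, induction for
    those kept, since [star] multiplies a constant by [1 - exp (- t) <= 1]. *)
Lemma N_le_linear (n : nat) (t : R) :
  0 <= t -> N 1 a n t <= INR n * a 1%nat.
Proof.
  assert (H1 : 0 <= a 1%nat) by (rewrite <- a_0; apply a_incr).
  assert (Ha : forall j, a j <= INR j * a 1%nat).
  { induction j as [|j IH]; [simpl; lra|].
    rewrite S_INR. pose proof (concave_le_linear j). lra. }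
  revert t. induction n as [n IH] using lt_wf_ind. intros t Ht.
  destruct (Nat.eq_dec n 0) as [->|Hn]; [simpl; lra|].
  destruct (N_attained a n t) as (j & Hj & ->); [lia|].
  assert (Nstar 1 a (n - j) t <= INR (n - j) * a 1%nat).
  { apply Rle_trans with (star (fun _ => INR (n - j) * a 1%nat) t).
    - apply star_le; auto using N_continuous.
      + intros x. apply continuous_const.
      + intros x Hx. apply IH; [lia|lra].
    - rewrite star_const. pose proof (exp_pos (- t)).
      assert (0 <= INR (n - j) * a 1%nat)
        by (apply Rmult_le_pos; [apply pos_INR|exact H1]).
      nra. }
  rewrite minus_INR in H by lia. specialize (Ha j). lra.
Qed.

Lemma Nstar_le_linear (n : nat) (t : R) :
  0 <= t -> Nstar 1 a n t <= INR n * a 1%nat.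
Proof.
  assert (H1 : 0 <= a 1%nat) by (rewrite <- a_0; apply a_incr).
  intros Ht. apply Rle_trans with (star (fun _ => INR n * a 1%nat) t).
  - apply star_le; auto using N_continuous.
    + intros x. apply continuous_const.
    + intros x Hx. apply N_le_linear. lra.
  - rewrite star_const. pose proof (exp_pos (- t)).
    assert (0 <= INR n * a 1%nat)
      by (apply Rmult_le_pos; [apply pos_INR|exact H1]).
    nra.
Qed.

(** Spending one missile per enemy earns [a 1] each time, up to an error that decays with time. The
    rate [1/2], slower than the [exp (- t)] of [star], is reproduced by [star] with only a factor 2,
    so no powers of [t] build up along the induction. *)
Lemma Nstar_ge_linear (n : nat) :
  exists C, 0 <= C /\ forall t, 0 <= t ->
    INR n * a 1%nat - C * exp (- t / 2) <= Nstar 1 a n t.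
Proof.
  assert (H1 : 0 <= a 1%nat) by (rewrite <- a_0; apply a_incr).
  induction n as [|n (C & HC & IH)].
  - exists 0. split; [lra|]. intros t Ht. rewrite Nstar_0. simpl. lra.
  - assert (0 <= INR (S n) * a 1%nat)
      by (apply Rmult_le_pos; [apply pos_INR|exact H1]).
    (* The factor 2 comes from [star_ge_exp]; the added term ensures its condition [m <= 2 * C]. *)
    exists (2 * (C + INR (S n) * a 1%nat)). split; [lra|]. intros t Ht.
    apply star_ge_exp; auto using N_continuous; [lra|].
    intros x Hx. specialize (IH x Hx).
    assert (HN : a 1%nat + Nstar 1 a (S n - 1) x <= N 1 a (S n) x)
      by (apply N_ge; lia).
    replace (S n - 1)%nat with n in HN by lia.
    pose proof (exp_pos (- x / 2)).
    assert (0 <= INR (S n) * a 1%nat * exp (- x / 2)) by nra.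
    rewrite S_INR in *. nra.
Qed.

Lemma Nstar_incr_limit (n : nat) (d : R) :
  d < a 1%nat ->
  exists t, 0 <= t /\ d <= Nstar 1 a (S n) t - Nstar 1 a n t.
Proof.
  intros Hd. destruct (Nstar_ge_linear (S n)) as (C & HC & H).
  assert (HC' : 0 <= C / (a 1%nat - d)) by (apply Rdiv_le_0_compat; lra).
  (* With [t = 2 * s] the error [C * exp (- t / 2)] equals [(a 1 - d) * (s * exp (- s))], and
     [s * exp (- s) <= 1]. *)
  exists (2 * (C / (a 1%nat - d))). split; [lra|].
  set (s := C / (a 1%nat - d)) in *.
  specialize (H (2 * s)). pose proof (Nstar_le_linear n (2 * s)).
  rewrite S_INR in H.
  replace (- (2 * s) / 2) with (- s) in H by field.
  assert (C * exp (- s) <= a 1%nat - d).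
  { replace C with (s * (a 1%nat - d)) by (unfold s; field; lra).
    assert (s * exp (- s) <= 1).
    { replace 1 with (exp s * exp (- s))
        by (rewrite <- exp_plus, Rplus_opp_r; apply exp_0).
      apply Rmult_le_compat_r; [apply Rlt_le, exp_pos|].
      pose proof (exp_ineq1_le s). lra. }
    nra. }
  lra.
Qed.

(** Exchange argument: optimal splits of [n + 2] and of [n] missiles are turned into two splits of
    [n + 1] by moving one missile between them, either among those kept or among those spent. *)
Lemma N_concave_step (n : nat) (t : R) :
  (forall r, (r < n)%nat ->
     Nstar 1 a r t + Nstar 1 a (S (S r)) t <= 2 * Nstar 1 a (S r) t) ->
  Nstar 1 a 1 t <= a 1%nat ->
  N 1 a n t + N 1 a (S (S n)) t <= 2 * N 1 a (S n) t.
Proof.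
  intros IH H1.
  set (g r := Nstar 1 a r t) in *.
  assert (Hge : forall i p, (1 <= i)%nat -> (i + p = S n)%nat ->
                  a i + g p <= N 1 a (S n) t).
  { intros i p Hi Hp. replace p with (S n - i)%nat by lia.
    apply N_ge. lia. }
  destruct (N_attained a (S (S n)) t) as (i & Hi & ->); [lia|].
  fold (g (S (S n) - i)%nat).
  remember (S (S n) - i)%nat as p eqn:Ep.
  (* For [n = 0] there is no split to exchange with, since [N 1 a 0 t] is 0 by convention. Spending
     1 of 2 is bounded by [H1], spending 2 of 2 by concavity of [a]. *)
  destruct (Nat.eq_dec n 0) as [->|Hn].
  - change (N 1 a 0 t) with 0.
    assert (Hg0 : g 0%nat = 0) by exact (Nstar_0 1 a t).
    assert (H0 : a 1%nat + g 0%nat <= N 1 a 1 t)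
      by exact (Hge 1%nat 0%nat (le_n 1) eq_refl).
    assert (Hi' : i = 1%nat \/ i = 2%nat) by lia.
    destruct Hi' as [-> | ->]; subst p; simpl Nat.sub.
    + unfold g in *. lra.
    + pose proof (a_conc 0). lra.
  - destruct (N_attained a n t) as (j & Hj & ->); [lia|].
    fold (g (n - j)%nat). remember (n - j)%nat as q eqn:Eq.
    destruct (le_lt_dec i j) as [Hij|Hij].
    + destruct p as [|p]; [lia|].
      assert (g q + g (S p) <= g (S q) + g p).
      { apply concave_exchange; [|lia]. intros r Hr. apply IH. lia. }
      assert (a i + g p <= N 1 a (S n) t) by (apply Hge; lia).
      assert (a j + g (S q) <= N 1 a (S n) t) by (apply Hge; lia).
      lra.
    + destruct i as [|i]; [lia|].
      assert (a j + a (S i) <= a (S j) + a i)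
        by (apply concave_exchange; [auto|lia]).
      assert (a i + g p <= N 1 a (S n) t) by (apply Hge; lia).
      assert (a (S j) + g q <= N 1 a (S n) t) by (apply Hge; lia).
      lra.
Qed.

(** [star] is additive and monotone, so it carries concavity of [N] to [Nstar]. The time is
    generalised in the induction because [star] at [t] uses [N] on all of [[0, t]]. *)
Lemma Nstar_concave (n : nat) (t : R) :
  0 <= t -> Nstar 1 a n t + Nstar 1 a (S (S n)) t <= 2 * Nstar 1 a (S n) t.
Proof.
  revert t. induction n as [n IH] using lt_wf_ind. intros t Ht.
  unfold Nstar. rewrite <- Rplus_diag, <- !star_plus
    by (intros; apply N_continuous).
  apply star_le; auto;
    try (intros; apply (continuous_plus (V := R_NormedModule));
         apply N_continuous).
  intros x Hx. rewrite Rplus_diag. apply N_concave_step.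
  - intros r Hr. apply IH; [exact Hr|lra].
  - pose proof (Nstar_le_linear 1 x). simpl in *. lra.
Qed.

End ConcaveHits.

(** * Identifying the policy and attaining each value *)

(** Only smaller [j] must be beaten strictly, because [K] takes the least maximiser; this permits
    the tie between [k] and [k + 1] that is produced below. *)
Lemma K_eq (u : R) (a : nat -> R) (n k : nat) (t : R) :
  (1 <= k <= n)%nat ->
  (forall j, (1 <= j < k)%nat -> Nspend u a n j t < Nspend u a n k t) ->
  (forall j, (k <= j <= n)%nat -> Nspend u a n j t <= Nspend u a n k t) ->
  K u a n t = k.
Proof.
  intros Hk Hlt Hle.
  destruct (K_spec u a n t) as (H1 & H2 & H3); [lia|].
  destruct (lt_eq_lt_dec (K u a n t) k) as [[H|H]|H]; [|exact H|].
  - specialize (H2 k Hk). specialize (Hlt (K u a n t)).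
    assert (Nspend u a n (K u a n t) t < Nspend u a n k t)
      by (apply Hlt; lia). lra.
  - specialize (Hle (K u a n t)). specialize (H3 k).
    assert (Nspend u a n k t < Nspend u a n (K u a n t) t)
      by (apply H3; lia).
    assert (Nspend u a n (K u a n t) t <= Nspend u a n k t)
      by (apply Hle; lia). lra.
Qed.

Lemma strict_mono_upto (f : nat -> R) (k j : nat) :
  (forall i, (j <= i < k)%nat -> f i < f (S i)) -> (j < k)%nat -> f j < f k.
Proof.
  intros H Hjk. induction Hjk as [|k Hjk IH]; [apply H; lia|].
  apply Rlt_trans with (f k); [apply IH; intros; apply H; lia|apply H; lia].
Qed.

Lemma antitone_from (f : nat -> R) (k j : nat) :
  (forall i, (k <= i < j)%nat -> f (S i) <= f i) -> (k <= j)%nat -> f j <= f k.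
Proof.
  intros H Hkj. induction Hkj as [|j Hkj IH]; [lra|].
  apply Rle_trans with (f j); [apply H; lia|apply IH; intros; apply H; lia].
Qed.

Theorem theorem4p3 (a : nat -> R)
  (ha0 : a 0%nat = 0)
  (ha_prob : forall j : nat, 0 <= a j <= 1)
  (ha_incr : forall j : nat, a j < a (S j))
  (ha_conc : forall j : nat, a (S (S j)) - a (S j) < a (S j) - a j)
  (n : nat) (hn : (1 <= n)%nat)
  (k : nat) (hk : (1 <= k <= n)%nat) :
  exists t : R, 0 <= t /\ K 1 a n t = k.
Proof.
  assert (Hinc : forall j, a j <= a (S j)) by (intros; apply Rlt_le, ha_incr).
  assert (Hconc : forall j, a j + a (S (S j)) <= 2 * a (S j))
    by (intros j; specialize (ha_conc j); lra).
  destruct (Nat.eq_dec k n) as [->|Hkn].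
  { exists 0. split; [lra|]. apply K_eq; [exact hk| |].
    - intros j Hj. apply (strict_mono_upto (fun j => Nspend 1 a n j _)); [|lia]. intros i Hi.
      rewrite !Nspend_1. unfold Nstar. rewrite !star_0.
      specialize (ha_incr i). lra.
    - intros j Hj. replace j with n by lia. lra. }
  assert (Hd : forall i j, (i < j)%nat -> a (S j) - a j < a (S i) - a i).
  { intros i j Hij. induction Hij as [|j Hij IH]; [apply ha_conc|].
    specialize (ha_conc j). lra. }
  (* [m] is the reserve left by [k + 1] missiles, so [D m] is what spending the last of them costs
     in future value. *)
  set (m := (n - S k)%nat).
  set (D r t := Nstar 1 a (S r) t - Nstar 1 a r t).
  assert (Ht : exists t, 0 <= t /\ D m t = a (S k) - a k).
  { destruct (Nstar_incr_limit a ha0 Hinc Hconc m (a (S k) - a k))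
      as (T & HT & HD).
    { specialize (Hd 0%nat k). rewrite ha0 in Hd.
      assert (a (S k) - a k < a 1%nat - 0) by (apply Hd; lia). lra. }
    destruct (IVT_gen_consistent (D m) 0 T (a (S k) - a k)) as (t & Hb & E).
    - intros x. apply (continuous_minus (V := R_NormedModule));
        apply Nstar_continuous.
    - assert (D m 0 = 0)
        by (unfold D, Nstar; rewrite !star_0; ring).
      fold (D m T) in HD. specialize (ha_incr k).
      rewrite Rmin_left, Rmax_right by lra. lra.
    - rewrite Rmin_left in Hb by lra. exists t. split; [lra|exact E]. }
  destruct Ht as (t & Ht & E). exists t. split; [exact Ht|].
  assert (HD : forall r s, (r <= s)%nat -> D s t <= D r t).
  { intros r s Hrs. apply (antitone_from (fun r => D r t)); [|exact Hrs].
    intros i _. unfold D.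
    pose proof (Nstar_concave a ha0 Hinc Hconc i t Ht). lra. }
  assert (Hstep : forall j, (j < n)%nat ->
            Nspend 1 a n (S j) t - Nspend 1 a n j t
            = a (S j) - a j - D (n - S j)%nat t).
  { intros j Hj. rewrite !Nspend_1. unfold D.
    replace (n - j)%nat with (S (n - S j)) by lia. ring. }
  apply K_eq; [exact hk| |].
  (* Below [k] the gain in [a] is strictly larger than at [k], while the reserve is larger and so
     [D] is no larger: each further missile strictly pays. *)
  - intros j Hj. apply (strict_mono_upto (fun j => Nspend 1 a n j _)); [|lia]. intros i Hi.
    specialize (Hstep i).
    assert (D (n - S i)%nat t <= D m t) by (apply HD; lia).
    assert (a (S k) - a k < a (S i) - a i) by (apply Hd; lia).
    assert (Hn' : (i < n)%nat) by lia. specialize (Hstep Hn'). lra.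
  (* From [k] on both comparisons reverse, with equality at [i = k] by the choice of [t]. *)
  - intros j Hj. apply (antitone_from (fun j => Nspend 1 a n j t)); [|lia].
    intros i Hi. specialize (Hstep i).
    assert (D m t <= D (n - S i)%nat t) by (apply HD; lia).
    assert (a (S i) - a i <= a (S k) - a k).
    { destruct (Nat.eq_dec i k) as [->|]; [lra|]. apply Rlt_le, Hd. lia. }
    assert (Hn' : (i < n)%nat) by lia. specialize (Hstep Hn'). lra.
Qed.
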